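(* Let $n\geq 3$ be an integer, let $C_n=\langle x\rangle$ be the cyclic group of order $n$ with identity $e$, and let $X\subseteq C_n\setminus\{e\}$. The dihedrant $Dih(n,X,X)$ is a DSRG with parameters $(2n,2|X|,\mu,\lambda,t)$ if and only if one of the following holds: (a) Let $v=\frac{n}{\mu-\lambda}$. There exists a subset $T$ of $\{x,x^2,\dots,x^{v-1}\}$ satisfying (i) $X=T\langle x^v\rangle$; (ii) $X\cup X^{(-1)}=C_n\setminus\langle x^v\rangle$. (b) Let $v=\frac{n}{\mu-\lambda}$. There exists a subset $T'$ of $\{x,x^2,\dots,x^{2v-1}\}$ satisfying (i) $X=T'\langle x^{2v}\rangle$; (ii) $X\uplus X^{(-1)}=(C_n\setminus\langle x^{2v}\rangle)\uplus x^v\langle x^{2v}\rangle$; (iii) $X\cup x^vX=C_n$.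
   Context: A directed graph on $N$ vertices with adjacency matrix $A$ is a directed strongly regular graph (DSRG) with parameters $(N,k,\mu,\lambda,t)$ if $JA=AJ=kJ$ and $A^2=tI+\lambda A+\mu(J-I-A)$, where $I$ is the identity matrix and $J$ the all-ones matrix. All DSRGs are assumed genuine, i.e. $0<t<k$. For a finite group $G$ with identity $e$ and $S\subseteq G\setminus\{e\}$, $\mathbf{Cay}(G,S)$ is the digraph with vertex set $G$ and an arc $g\to h$ if and only if $g^{-1}h\in S$. The dihedral group is $D_n=\langle x,\tau\mid x^n=1,\tau^2=1,\tau x=x^{-1}\tau\rangle$, with $C_n=\langle x\rangle\leq D_n$. For $X,Y\subseteq C_n$, $Dih(n,X,Y)=\mathbf{Cay}(D_n,X\cup Y\tau)$; Cayley graphs on dihedral groups are called dihedrants. $X^{(-1)}=\{g^{-1}:g\in X\}$. For sets, $\cup$ and $\setminus$ denote the usual union and difference; $\uplus$ denotes the multiset union, in which multiplicities add. For a divisor $w$ of $n$ and a subset $T$ of $\{e,x,\dots,x^{w-1}\}$, $T\langle x^w\rangle$ is the union of the cosets $s\langle x^w\rangle$ with $s\in T$.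
   Formalization: In (a)(ii) the union of X and X^(-1) is required to be disjoint; in (a) and (b) v>1 is required; the ''if'' direction gives a DSRG with some μ, λ, t having the given difference μ−λ, since the conditions do not determine prescribed μ, λ, t. *)

(* Defs.v *)
From mathcomp Require Import all_boot all_order all_algebra.
From mathcomp Require Import all_fingroup all_solvable.

Set Implicit Arguments.
Unset Strict Implicit.
Unset Printing Implicit Defensive.

(* A digraph is a relation on a finite type; its vertices are numbered by
   [enum_val] to form the adjacency matrix. *)
Definition adj (V : finType) (e : rel V) : 'M[int]_#|V| :=
  (\matrix_(i, j) (e (enum_val i) (enum_val j))%:R)%R.

(* The bounds on [t] are the genuineness condition. *)
Definition is_dsrg (V : finType) (e : rel V) (N k mu la t : nat) : Prop :=
  let A := adj e in
  let J : 'M[int]_#|V| := const_mx 1%R in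
  [/\ #|V| = N,
      (J *m A = k%:R *: J)%R,
      (A *m J = k%:R *: J)%R,
      (A *m A = t%:R *: 1%:M + la%:R *: A + mu%:R *: (J - 1%:M - A))%R
    & 0 < t < k].

Definition cay (gT : finGroupType) (S : {set gT}) : rel gT :=
  fun g h => (g^-1 * h)%g \in S.

(* [x] and [tau] are generators of the dihedral group of order [2 * n]
   satisfying its defining relations; as the order of the group is [2 * n],
   this forces [x] to have order [n] and [tau] to be outside [<[x]>]. *)
Definition dihedral_gens (n : nat) (x tau : 'D_(n.*2)) : Prop :=
  [/\ <<[set x; tau]>>%g = [set: 'D_(n.*2)],
      (x ^+ n = 1)%g,
      (tau ^+ 2 = 1)%g
    & (tau * x = x^-1 * tau)%g].

Definition dih (gT : finGroupType) (tau : gT) (X Y : {set gT}) : rel gT :=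
  cay (X :|: Y :* tau)%g.

(* Multiset union, a multiset being represented by its multiplicities. *)
Definition msetU (T : finType) (A B : {set T}) : {ffun T -> nat} :=
  [ffun g => (g \in A) + (g \in B)].

(* {x, x^2, ..., x^(w-1)} *)
Definition powers_lt (gT : finGroupType) (x : gT) (w : nat) : {set gT} :=
  [set (x ^+ i)%g | i : 'I_w & 0 < i].

(* In the next two conditions [d] is the difference mu - lambda, so that
   [v * d = n] says that v = n / (mu - lambda) is an integer.  The degenerate
   value v = 1 has to be excluded: it gives the empty graph in the first case
   and the complete bipartite graph K_{n,n} in the second, where t = k.

   The union of X and X^(-1) in [dih_cond_a] is a disjoint one; without
   disjointness the condition would hold for n = v = 3 and X = {x, x^2}, for
   which the dihedrant is K_{2,2,2}, where t = k. *)
Definition dih_cond_a (n : nat) (gT : finGroupType) (x : gT) (X : {set gT})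
    (d : int) : Prop :=
  exists v : nat, [/\ 1 < v, (v%:Z * d = n%:Z)%R &
    exists T : {set gT},
      [/\ T \subset powers_lt x v,
          X = (T * <[x ^+ v]>)%g,
          (X :|: X^-1 = <[x]> :\: <[x ^+ v]>)%g
        & [disjoint X & X^-1%g]]].

Definition dih_cond_b (n : nat) (gT : finGroupType) (x : gT) (X : {set gT})
    (d : int) : Prop :=
  exists v : nat, [/\ 1 < v, (v%:Z * d = n%:Z)%R, v.*2 %| n &
    exists T' : {set gT},
      [/\ T' \subset powers_lt x v.*2,
          X = (T' * <[x ^+ v.*2]>)%g,
          msetU X X^-1%g =
            msetU (<[x]> :\: <[x ^+ v.*2]>)%g (x ^+ v *: <[x ^+ v.*2]>)%g
        & (X :|: x ^+ v *: X = <[x]>)%g]].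

(* Main.v *)
(* Let C = <x>, d = mu - lambda, and let M = X + X^(-1) in the group ring of C.
   Expanding (X + X tau)^2 shows that Dih(n,X,X) is a DSRG exactly when t = mu
   and X M = mu C - d X; adding the inverse of this identity, M^2 = 2 mu C - d M.
   As M(1) = 0, this yields sum_y (M(y) - M(y^-1 g))^2 = 2 d M(g), so d > 0 and
   the zeros of M are exactly the periods of M; they form a subgroup H, and X is
   H-periodic.  Passing to Q = C / H, with d = |H| delta, M becomes Q - 1 + B
   where B is the set of y with both y and y^-1 in X / H, and
   (B - 1)(B - 1 + delta) = c Q.  If B is empty then delta = 1, which is (a).
   Otherwise B <> Q - 1 because t < k, and a single prime p dividing |Q| suffices
   to show that B consists of the involution of Q and delta = 2, which is (b):
   by Frobenius, modulo p and up to a multiple of Q, B^(p) is B if p does not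
   divide delta, and 1 if it does.  In the first case B is constant off the
   proper subgroup of p-th powers, in the second 1 has exactly one p-th root in
   B; counting finishes both cases. *)

Require Import Defs.
From mathcomp Require Import all_boot all_order all_algebra.
From mathcomp Require Import all_fingroup all_solvable.
From mathcomp Require Import ring lra zify.

Set Implicit Arguments.
Unset Strict Implicit.
Unset Printing Implicit Defensive.
Import GroupScope Order.TTheory GRing.Theory Num.Theory.

Local Notation "[ 'ind' g 'in' A ]" := ((g \in A)%:R)%R
  (at level 0, g at level 69, A at level 69, format "[ 'ind'  g  'in'  A ]") : ring_scope.

(** The regular representation of the group algebra: [f] stands for the formal sum of the [f g]
    times [g]. Adjacency matrices of Cayley graphs have this form, and matrices supply the ring in
    which Frobenius is applied. *)
Definition conv_mx (gT : finGroupType) (R : pzRingType) (f : gT -> R) :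
    'M[R]_#|gT| :=
  (\matrix_(i, j) f ((enum_val i)^-1 * enum_val j)%g)%R.

(** * Convolution matrices and Frobenius *)

Section ConvolutionMatrices.
Local Open Scope ring_scope.
Variables (gT : finGroupType) (R : pzRingType).
Implicit Types (f g : gT -> R).

Lemma eq_conv_mx f g : f =1 g -> conv_mx f = conv_mx g.
Proof. by move=> fg; apply/matrixP => i j; rewrite !mxE fg. Qed.

Lemma conv_mx_inj f g : conv_mx f = conv_mx g -> f =1 g.
Proof.
move=> /matrixP fg y; move: (fg (enum_rank 1%g) (enum_rank y)).
by rewrite !mxE !enum_rankK invg1 mul1g.
Qed.

Lemma conv_mxM f g :
  conv_mx f *m conv_mx g = conv_mx (fun q => \sum_y f y * g (y^-1 * q)%g).
Proof.
apply/matrixP => i j; rewrite !mxE.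
rewrite [RHS](reindex_inj (mulgI (enum_val i)^-1)%g) /=.
have := big_enum_val (op := +%R) (A := gT) (fun k =>
  f ((enum_val i)^-1 * k)%g * g (((enum_val i)^-1 * k)^-1 *
    ((enum_val i)^-1 * enum_val j))%g).
move=> H; rewrite (eq_bigl (fun k => k \in gT)); last by [].
rewrite H; apply: eq_bigr => k _; rewrite !mxE; congr (_ * g _).
by rewrite invMg invgK -mulgA mulKVg.
Qed.

Lemma conv_mx1 : conv_mx (fun q : gT => (q == 1%g)%:R) = 1 :> 'M[R]_#|gT|.
Proof.
rewrite -[RHS]/(1%:M); apply/matrixP => i j; rewrite !mxE.
by rewrite -eq_mulVg1 (inj_eq enum_val_inj).
Qed.

Lemma conv_mxD f g : conv_mx f + conv_mx g = conv_mx (fun q => f q + g q).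
Proof. by apply/matrixP => i j; rewrite !mxE. Qed.

Lemma conv_mxB f g : conv_mx f - conv_mx g = conv_mx (fun q => f q - g q).
Proof. by apply/matrixP => i j; rewrite !mxE. Qed.

Lemma conv_mxZ a f : a *: conv_mx f = conv_mx (fun q => a * f q).
Proof. by apply/matrixP => i j; rewrite !mxE. Qed.

Definition point_mx (y : gT) : 'M[R]_#|gT| := conv_mx (fun q => (q == y)%:R).

Lemma point_mxM y z : point_mx y *m point_mx z = point_mx (y * z)%g.
Proof.
rewrite conv_mxM; apply: eq_conv_mx => q.
rewrite (bigD1 y) //= eqxx mul1r big1 ?addr0 => [|u /negPf->]; last by rewrite mul0r.
by rewrite -(inj_eq (mulgI y)) mulKVg.
Qed.

Lemma point_mxX y k : (point_mx y : 'M[R]_#|gT|) ^+ k = point_mx (y ^+ k)%g.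
Proof.
elim: k => [|k IH]; first by rewrite expr0 expg0 /point_mx conv_mx1.
by rewrite exprS expgS IH; exact: point_mxM.
Qed.

Lemma conv_mx_set (f : gT -> gT) (B : {set gT}) :
  \sum_(y in B) point_mx (f y) = conv_mx (fun q => #|[set y in B | f y == q]|%:R).
Proof.
apply/matrixP => i j; rewrite summxE mxE -sum1_card natr_sum.
rewrite (eq_bigl (fun y => (y \in B) && (f y == (enum_val i)^-1 * enum_val j)%g)).
  rewrite big_mkcondr /=; apply: eq_bigr => y _; rewrite mxE eq_sym.
  by case: eqP.
by move=> y; rewrite inE.
Qed.

Lemma conv_mx_ind (B : {set gT}) :
  conv_mx (fun q => [ind q in B]) = \sum_(y in B) point_mx y.
Proof.
rewrite conv_mx_set; apply: eq_conv_mx => q; congr (_%:R).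
case: (boolP (q \in B)) => [qB|qB].
  rewrite (_ : [set y in B | y == q] = [set q]) ?cards1 //.
  by apply/setP=> y; rewrite !inE andbC; case: eqP => [->|].
rewrite (_ : [set y in B | y == q] = set0) ?cards0 //.
by apply/setP=> y; rewrite !inE andbC; case: eqP => [->|//]; rewrite (negPf qB).
Qed.

End ConvolutionMatrices.

(** * Frobenius in characteristic p *)

Section Frobenius.
Local Open Scope ring_scope.
Variables (R : pzRingType) (p : nat).
Hypotheses (p_pr : prime p) (p0 : p%:R = 0 :> R).

(** The inner binomial coefficients are divisible by [p]; commutation is required of [x] and [y]
    alone because the ring will be a matrix ring. *)
Lemma exprD_prime_comm (x y : R) :
  GRing.comm x y -> (x + y) ^+ p = x ^+ p + y ^+ p.
Proof.
move=> cxy; have defp := prednK (prime_gt0 p_pr).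
rewrite exprDn_comm // big_ord_recr subnn -defp big_ord_recl /= defp.
rewrite subn0 mulr1 mul1r bin0 binn big1 ?addr0 // => i _.
rewrite -mulr_natr.
have /dvdnP[k ->]: (p %| 'C(p, bump 0 i))%N.
  apply: prime_dvd_bin => //; rewrite /bump leq0n add1n /=.
  by rewrite -[X in (_ < X)%N]defp ltnS; case: (i).
by rewrite natrM p0 !mulr0.
Qed.

Lemma exprD_prime_comm_sum (I : finType) (A : {set I}) (F : I -> R) :
    (forall i j, i \in A -> j \in A -> GRing.comm (F i) (F j)) ->
  (\sum_(i in A) F i) ^+ p = \sum_(i in A) F i ^+ p.
Proof.
move=> cF; have [m] := ubnP #|A|; elim: m A cF => // m IH A cF leA.
have [->|[a aA]] := set_0Vmem A.
  by rewrite !big_set0 -(prednK (prime_gt0 p_pr)) expr0n.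
rewrite !(big_setD1 a aA) /= exprD_prime_comm ?IH //.
- by move=> i j /setD1P[_ iA] /setD1P[_ jA]; apply: cF.
- by move: leA; rewrite (cardsD1 a) aA.
- by apply: commr_sum => i /setD1P[_ iA]; apply: cF.
Qed.

End Frobenius.

Lemma Fp_expf_pred p (a : 'F_p) : prime p ->
  (a ^+ p.-1 = (a != 0)%:R :> 'F_p)%R.
Proof.
move=> p_pr; have p1 := prime_gt1 p_pr.
have [->|a0] := eqVneq a 0%R; first by rewrite expr0n -subn1 subn_eq0 leqNgt p1.
have e : (a ^+ p = a)%R.
  have [k ->] : exists k : nat, a = (k%:R)%R by exists (a : nat); rewrite natr_Zp.
  by rewrite -natrX -Fp_nat_mod // fermat_little // Fp_nat_mod.
by apply: (mulfI a0); rewrite -exprS prednK ?mulr1 // ltnW.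
Qed.

(** * Counting p-th roots in B modulo p *)

Section FrobeniusCount.
Local Open Scope ring_scope.
Variables (gT : finGroupType) (Q : {group gT}) (B : {set gT}) (p : nat).
Variables (c e : int).
Hypotheses (abQ : abelian Q) (sBQ : B \subset Q) (p_pr : prime p).
Hypothesis convB : forall q, q \in Q ->
  \sum_(y in B) [ind (y^-1 * q)%g in B] =
    c + (2 - e) * [ind q in B] + (e - 1) * (q == 1%g)%:R :> int.

(* With r = B - 1 in the group algebra over F_p, [convB] reads r^2 = -e r + cQ,
   so r^p = (-e)^(p-1) r + aQ, while r^p = B^(p) - 1 by Frobenius. *)
Lemma card_prime_root_mod : exists a : 'F_p, forall q, q \in Q ->
  #|[set y in B | y ^+ p == q]%g|%:R =
    (q == 1%g)%:R + (e%:~R != 0 :> 'F_p)%:R * ([ind q in B] - (q == 1%g)%:R) + a.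
Proof.
set dl : 'F_p := e%:~R; pose A := 'M['F_p]_#|gT|.
pose b : A := conv_mx (fun q => [ind q in B]).
pose J : A := conv_mx (fun q => [ind q in Q]); pose r := b - 1.
have p0 : p%:R = 0 :> 'F_p by case/andP: (pchar_Fp p_pr) => _ /eqP.
have pA0 : p%:R = 0 :> A.
  have -> : (p%:R : A) = (p%:R)%:M by rewrite (raddfMn scalar_mx).
  by rewrite p0 raddf0.
have rE : r = conv_mx (fun q => [ind q in B] - (q == 1%g)%:R).
  by rewrite /r /b -(conv_mx1 gT 'F_p) conv_mxB.
have r2 : r * r = (- dl) *: r + c%:~R *: J.
  have -> : r * r = b * b - b - r.
    by rewrite {1}/r mulrBl mul1r /r mulrBr mulr1.
  rewrite rE /b -mulmxE conv_mxM !conv_mxB !conv_mxZ conv_mxD.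
  apply: eq_conv_mx => q.
  have [qQ|qQ] := boolP (q \in Q); last first.
    rewrite big1 => [|y _].
      have /negPf-> : q \notin B by apply: contra qQ; apply: (subsetP sBQ).
      have /negPf-> : q != 1%g by apply: contra qQ => /eqP->.
      by rewrite !subr0 !mulr0 addr0.
    have [yB|] := boolP (y \in B); last by rewrite mul0r.
    rewrite (_ : (y^-1 * q \in B)%g = false) ?mulr0 //; apply: contraNF qQ => yqB.
    by rewrite -(mulKVg y q) groupM // (subsetP sBQ).
  have := congr1 (intr : int -> 'F_p) (convB qQ).
  rewrite rmorph_sum /= => E.
  transitivity ((\sum_(y in B) [ind (y^-1 * q)%g in B] : 'F_p) - [ind q in B]
      - ([ind q in B] - (q == 1%g)%:R)).
    congr (_ - _ - _); rewrite [RHS]big_mkcond; apply: eq_bigr => y _.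
    by case: (y \in B); rewrite ?mul1r ?mul0r.
  have {}E : \sum_(y in B) [ind (y^-1 * q)%g in B] =
     c%:~R + (2 - dl) * [ind q in B] + (dl - 1) * (q == 1%g)%:R :> 'F_p.
    rewrite -[LHS](eq_bigr _ (fun i _ => rmorph_nat intr _)) E /dl.
    by rewrite !rmorphD !rmorphM !rmorphB /= !rmorph_nat rmorph1.
  by rewrite E mulr1; ring.
(* Q absorbs whatever is supported in it, so J r is |B| - 1 times J, and all positive powers of r
   stay in the span of r and J. *)
have Jr : exists a, J * r = a *: J.
  exists (\sum_y [ind y in B] - 1); rewrite rE -mulmxE conv_mxM conv_mxZ.
  apply: eq_conv_mx => q.
  rewrite (reindex_inj (mulgI q)) /= (reindex_inj invg_inj) /=.
  have [qQ|qQ] := boolP (q \in Q); last first.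
    rewrite mulr0 big1 // => y _; rewrite invMg invgK mulgKV.
    have [yB|yB] := boolP (y \in B).
      rewrite (_ : (q * y^-1 \in Q)%g = false) ?mul0r //; apply: contraNF qQ.
      by rewrite groupMr // groupV (subsetP sBQ).
    have [->|] := eqVneq y 1%g; last by rewrite subrr mulr0.
    by rewrite invg1 mulg1 (negPf qQ) mul0r.
  rewrite mulr1 (eq_bigr (fun y => [ind y in B] - (y == 1%g)%:R)).
    rewrite sumrB; congr (_ - _).
    by rewrite (bigD1 1%g) //= eqxx big1 ?addr0 // => y /negPf->.
  move=> y _; rewrite invMg invgK mulgKV groupMl //.
  rewrite groupV; have [yQ|yQ] := boolP (y \in Q); first by rewrite mul1r.
  have /negPf-> : y \notin B by apply: contra yQ; apply: (subsetP sBQ).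
  have /negPf-> : y != 1%g by apply: contra yQ => /eqP->.
  by rewrite subrr mulr0.
have rX k : exists a, r ^+ k.+1 = (- dl) ^+ k *: r + a *: J.
  case: Jr => j Jr; elim: k => [|k [a IH]].
    by exists 0; rewrite expr1 expr0 scale1r scale0r addr0.
  exists ((- dl) ^+ k * c%:~R + a * j).
  rewrite exprSr IH mulrDl -!mulmxE -!scalemxAl !mulmxE r2 Jr scalerDr !scalerA -exprSr.
  by rewrite -addrA -scalerDl.
have [a ra] := rX p.-1; exists a => q qQ.
have bp : b ^+ p = 1 + (- dl) ^+ p.-1 *: r + a *: J.
  rewrite -[b](subrK 1) -/r exprD_prime_comm ?expr1n //; last exact: commr1.
  by rewrite -addrA -ra prednK ?prime_gt0 // addrC.
(* The same power taken termwise is the sum of the y^p over y in B; its coefficient at q counts the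
   p-th roots of q in B. *)
have := bp; rewrite /b conv_mx_ind exprD_prime_comm_sum //; last first.
  move=> y z yB zB; rewrite /GRing.comm -!mulmxE !point_mxM.
  by rewrite (centsP abQ) // (subsetP sBQ).
under eq_bigr => y yB do rewrite point_mxX.
rewrite conv_mx_set rE -(conv_mx1 gT 'F_p) !conv_mxZ !conv_mxD => /conv_mx_inj/(_ q) /= ->.
by rewrite Fp_expf_pred // oppr_eq0 qQ mulr1.
Qed.
End FrobeniusCount.

(** * The set B in a cyclic group *)

Section CountingArithmetic.
Local Open Scope ring_scope.
Variables (b c e w : int).
Hypotheses (h1 : b = c + e - 1) (hT : b ^+ 2 = c * w + (2 - e) * b + (e - 1)).

(** In these three lemmas b = |B| and w = |Q|; [h1] is the coefficient at 1 and [hT] the coefficient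
    sum of the identity for B^2. The further hypothesis is its coefficient at one well-chosen
    element. *)
Lemma counting_disjoint : c = 0 -> b * (b - 1) = 0.
Proof. by move=> c0; move: h1 hT; rewrite c0 => ->; lra. Qed.

Lemma counting_cover : c + (2 - e) = b - (w - b) -> (e - 1) * (e - 2) = 0.
Proof.
move=> h2; have cE : c = b - e + 1 by rewrite h1; ring.
have wE : w = b + 2 * e - 3 by move: h1 h2; lra.
by move: hT; rewrite cE wE; lra.
Qed.

Lemma counting_translate : c + (2 - e) = b - 1 -> e = 2 /\ (b - 1) * (b + 1 - w) = 0.
Proof.
move=> h2; have e2 : e = 2 by move: h1 h2; lra.
have cE : c = b - 1 by rewrite h1 e2; ring.
by split=> //; move: hT; rewrite cE e2; lra.
Qed.
End CountingArithmetic.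

(** * Symmetric sets B with B^2 in the span of 1, B and Q *)

Section Involution.
Local Open Scope ring_scope.
Variables (gT : finGroupType) (Q : {group gT}) (B : {set gT}) (c e : int).
Hypotheses (cQ : cyclic Q) (sBQ : B \subset Q).
Hypothesis convB : forall q, q \in Q ->
  \sum_(y in B) [ind (y^-1 * q)%g in B] =
    c + (2 - e) * [ind q in B] + (e - 1) * (q == 1%g)%:R :> int.
Hypotheses (B1 : 1%g \notin B) (BV : forall y, y \in B -> y^-1%g \in B).

Lemma conv_at1 : #|B|%:R = c + e - 1.
Proof.
have := convB (group1 Q); rewrite (negPf B1) eqxx mulr0 mulr1 addr0 addrA => <-.
rewrite -sum1_card natr_sum; apply: eq_bigr => y yB.
by rewrite mulg1 BV.
Qed.

(** This is the trivial character applied to [convB]. *)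
Lemma conv_total : #|B|%:R ^+ 2 = c * #|Q|%:R + (2 - e) * #|B|%:R + (e - 1).
Proof.
have : \sum_(q in Q) \sum_(y in B) [ind (y^-1 * q)%g in B] = \sum_(q in Q)
    (c + (2 - e) * [ind q in B] + (e - 1) * (q == 1%g)%:R) :> int.
  exact: eq_bigr.
rewrite exchange_big /=.
rewrite (eq_bigr (fun y => #|B|%:R)); last first.
  move=> y yB; have yQ := subsetP sBQ _ yB.
  rewrite (reindex_inj (mulgI y)) /= -sum1_card natr_sum [RHS]big_mkcond.
  rewrite [LHS]big_mkcond; apply: eq_bigr => q _; rewrite mulKg groupMl //.
  have [qB|] := boolP (q \in B); last by rewrite if_same.
  by rewrite (subsetP sBQ).
rewrite sumr_const -(mulr_natr _%:R) -expr2 => ->.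
rewrite !big_split /= sumr_const -(mulr_natr c) -!mulr_sumr; congr (_ + _ * _ + _).
  rewrite -sum1_card natr_sum [RHS]big_mkcond [LHS]big_mkcond.
  apply: eq_bigr => q _; have [qB|] := boolP (q \in B); last by rewrite if_same.
  by rewrite (subsetP sBQ).
rewrite (bigD1 1%g) //= eqxx big1 ?addr0 ?mulr1 // => y /andP[_ /negPf->] //.
Qed.

Lemma involution_of_card1 : #|B| = 1%N -> (1 < #|Q|)%N ->
  exists z, [/\ B = [set z], (z * z = 1)%g & e = 2].
Proof.
move=> B_1 Q_gt1; have /cards1P[z Bz] := introT eqP B_1.
exists z; split=> //; first last.
  have := conv_at1; have := conv_total; rewrite B_1 => h1 h2.
  have : c * #|Q|%:R = 0 by move: h1 h2; lra.
  move/eqP; rewrite mulf_eq0 => /orP[/eqP c0|]; first by move: h2; lra.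
  by rewrite pnatr_eq0 => /eqP Q0; rewrite Q0 in Q_gt1.
have : (z^-1)%g \in B by rewrite BV // Bz set11.
by rewrite Bz => /set1P zV; rewrite -{1}zV mulVg.
Qed.

(** By Cauchy some x other than 1 has x^p = 1, so the p-th power map on the finite set Q is not
    injective, hence not onto. *)
Lemma abelian_nonpower p : prime p -> (p %| #|Q|)%N ->
  exists2 g, g \in Q & forall y, y \in Q -> (y ^+ p)%g != g.
Proof.
move=> p_pr pQ; have [x xQ ox] := Cauchy p_pr pQ.
pose f (y : gT) := (y ^+ p)%g.
have [sub|/subsetPn[g gQ gN]] := boolP (Q \subset f @: Q); last first.
  by exists g => // y yQ; apply: contra gN => /eqP<-; apply: imset_f.
have /imset_injP inj : #|f @: Q| == #|Q|.
  by rewrite eqn_leq leq_imset_card subset_leq_card.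
have /eqP : x = 1%g.
  by apply: inj => //; rewrite /f expg1n -ox expg_order.
by rewrite -order_eq1 ox; case: (p) p_pr => [|[]].
Qed.

(** The roots form a cyclic subgroup, whose generator has order dividing p. *)
Lemma cyclic_card_roots p : (0 < p)%N -> (#|[set y in Q | y ^+ p == 1]%g| <= p)%N.
Proof.
move=> p0; have abQ := cyclic_abelian cQ.
have gE : group_set [set y in Q | y ^+ p == 1]%g.
  apply/group_setP; split=> [|y z]; first by rewrite inE group1 expg1n /=.
  rewrite !inE => /andP[yQ /eqP yp] /andP[zQ /eqP zp].
  by rewrite groupM // expgMn ?yp ?zp ?mulg1 //=; apply: (centsP abQ).
have /cyclicP[u Eu] : cyclic (Group gE).
  by apply: cyclicS cQ; apply/subsetP=> y; rewrite inE => /andP[].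
have : u \in Group gE by rewrite Eu cycle_id.
rewrite inE => /andP[_ /eqP up].
move: Eu; rewrite /= => ->; rewrite dvdn_leq //.
by rewrite order_dvdn up.
Qed.

Lemma two_eigenvalue_involution q0 :
    B != set0 -> q0 \in Q -> q0 != 1%g -> q0 \notin B ->
  exists z, [/\ B = [set z], (z * z = 1)%g & e = 2].
Proof.
move=> B0 q0Q q01 q0B; have abQ := cyclic_abelian cQ.
have BQ2 : (#|B| + 2 <= #|Q|)%N.
  rewrite -(cardsID B Q) (setIidPr sBQ) leq_add2l.
  rewrite (cardsD1 1%g) (cardsD1 q0) !inE group1 B1 q0Q q0B q01 /=.
  by rewrite addnA leq_addr.
have B_gt0 : (0 < #|B|)%N by rewrite card_gt0.
have Q_gt1 : (1 < #|Q|)%N by lia.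
apply: involution_of_card1 => //.
pose p := pdiv #|Q|; have p_pr : prime p := pdiv_prime Q_gt1.
have [g gQ gN] := abelian_nonpower p_pr (pdiv_dvd _).
have g1 : g != 1%g by rewrite eq_sym -(expg1n _ p) gN.
have [a aP] := card_prime_root_mod abQ sBQ p_pr convB.
have h1 := conv_at1; have hT := conv_total.
(* An element that is no p-th power has root count 0. So if e is nonzero modulo p, B contains all
   such elements or none. *)
have nonpow q : q \in Q -> (forall y, y \in Q -> (y ^+ p)%g != q) ->
    (e%:~R != 0 :> 'F_p)%:R * [ind q in B] + a = 0.
  move=> qQ qN; have /negPf q1 : q != 1%g by rewrite eq_sym -(expg1n _ p) qN.
  have := aP q qQ; rewrite q1 subr0 add0r => <-.
  rewrite (_ : [set y in B | _] = set0) ?cards0 //.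
  apply/setP=> y; rewrite !inE; apply/andP=> [[yB /eqP yq]].
  by have := qN y (subsetP sBQ _ yB); rewrite yq eqxx.
have [e0|e0] := eqVneq (e%:~R : 'F_p) 0; last first.
  rewrite e0 in nonpow.
  have [gB|gB] := boolP (g \in B); last first.
    (* Here B consists of p-th powers, so g is not a product of two elements of B: its coefficient c
       vanishes. *)
    have a0 : a = 0 by have := nonpow _ gQ gN; rewrite (negPf gB) mulr0 add0r.
    have BK y : y \in B -> exists2 u, u \in Q & (u ^+ p)%g = y.
      move=> yB; have yQ := subsetP sBQ _ yB.
      have [/exists_inP[u uQ /eqP uy]|] :=
        boolP [exists u in Q, (u ^+ p)%g == y]; first by exists u.
      rewrite negb_exists_in => /forall_inP yN.
      have := nonpow y yQ yN; rewrite yB a0 addr0 mulr1 => /eqP.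
      by rewrite oner_eq0.
    have := convB gQ; rewrite (negPf gB) (negPf g1) !mulr0 !addr0 big1 => [c0|y yB].
      have := counting_disjoint h1 hT (esym c0).
      move/eqP; rewrite mulf_eq0 pnatr_eq0 -[_ == 0]negbK -lt0n B_gt0 /=.
      by rewrite subr_eq0 (eqr_nat int _ 1) => /eqP.
    rewrite [_ \in B](_ : _ = false) //; apply/negP=> /BK[v vQ vE].
    have [u uQ uE] := BK y yB; have /eqP[] := gN (u * v)%g (groupM uQ vQ).
    rewrite expgMn; last by apply: (centsP abQ).
    by rewrite uE vE mulKVg.
  (* Now the complement of B consists of p-th powers, so in g = y (y^-1 g) at most one factor lies
     outside B. The coefficient at g is therefore |B| minus the size of the complement. *)
  have a1 : a = -1.
    by have := nonpow _ gQ gN; rewrite gB mulr1 => /eqP; rewrite addrC addr_eq0 => /eqP.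
  have NK q : q \in Q :\: B -> exists2 u, u \in Q & (u ^+ p)%g = q.
    case/setDP => qQ qB.
    have [/exists_inP[u uQ /eqP uy]|] :=
      boolP [exists u in Q, (u ^+ p)%g == q]; first by exists u.
    rewrite negb_exists_in => /forall_inP qN.
    have := nonpow q qQ qN; rewrite (negPf qB) a1 mulr0 add0r => /eqP.
    by rewrite oppr_eq0 oner_eq0.
  have := convB gQ; rewrite gB (negPf g1) mulr0 addr0 mulr1.
  rewrite (_ : \sum_(y in B) _ = #|B|%:R - (#|Q|%:R - #|B|%:R)); last first.
    have -> : #|Q|%:R - #|B|%:R = \sum_(u in Q :\: B) 1 :> int.
      rewrite sumr_const -(cardsID B Q) (setIidPr sBQ) natrD; ring.
    have -> : \sum_(u in Q :\: B) 1 =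
       \sum_(y in B) (1 - [ind (y^-1 * g)%g in B]) :> int.
      rewrite (reindex_inj (mulIg g)) /= (reindex_inj invg_inj) /=.
      rewrite [LHS]big_mkcond [RHS]big_mkcond; apply: eq_bigr => y _.
      rewrite !inE groupMr // groupV.
      have [yQ|yQ] := boolP (y \in Q); last first.
        rewrite andbF; case: ifP => // yB; case/negP: yQ.
        by rewrite (subsetP sBQ).
      rewrite andbT; case: (boolP (y^-1 * g \in B)%g) => yB /=.
        by rewrite subrr if_same.
      rewrite subr0; case: ifP => // /negbT nyB.
      have [|u uQ uE] := NK y; first by rewrite inE nyB.
      have [|v vQ vE] := NK (y^-1 * g)%g; first by rewrite inE yB groupM ?groupV.
      have /eqP[] := gN (u * v)%g (groupM uQ vQ).
      by rewrite expgMn ?uE ?vE ?mulKVg //; apply: (centsP abQ).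
    rewrite sumrB sumr_const; ring.
  move=> h2; exfalso.
  (* Both e = 1 and e = 2 make |B| at least |Q| - 1, contrary to [BQ2]. *)
  have /eqP := counting_cover h1 hT (esym h2); rewrite mulf_eq0 !subr_eq0.
  by case/orP=> /eqP ee; move: h1 h2 BQ2; rewrite ee; clear; lia.
(* Now p divides e: modulo p, 1 has one p-th root in B and every other element of Q has none. *)
have ap : a = 0 by have := nonpow _ gQ gN; rewrite e0 eqxx mul0r add0r.
have {}aP q : q \in Q -> (#|[set y in B | y ^+ p == q]%g|%:R = (q == 1%g)%:R :> 'F_p).
  by move=> qQ; rewrite aP // e0 eqxx mul0r ap !addr0.
have p_gt1 := prime_gt1 p_pr.
set S1 := [set y in B | y ^+ p == 1]%g.
(* Since 1 is a p-th root of itself outside B, fewer than p roots lie in B, and the congruence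
   leaves exactly one. *)
have S1lt : (#|S1| < p)%N.
  rewrite (leq_trans _ (cyclic_card_roots (ltnW p_gt1))) //.
  rewrite [X in (_ < X)%N](cardsD1 1%g) inE group1 expg1n eqxx add1n ltnS.
  apply/subset_leq_card/subsetP=> y; rewrite !inE => /andP[yB ->].
  rewrite (subsetP sBQ) //= andbT; apply: contra B1 => /eqP<- //.
have /cards1P[z S1z] : #|S1| == 1%N.
  have := aP _ (group1 Q); rewrite eqxx -/S1 => /(congr1 (@nat_of_ord _)).
  by rewrite !val_Fp_nat // (modn_small S1lt) (modn_small p_gt1) => ->.
have zS1 : z \in S1 by rewrite S1z set11.
have [zB /eqP zp] : z \in B /\ (z ^+ p == 1)%g.
  by move: zS1; rewrite inE => /andP[].
have zQ := subsetP sBQ _ zB.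
have z1 : z != 1%g by apply: contra B1 => /eqP<-.
(* The inverse of z is such a root too, so z is an involution, which forces p = 2. *)
have zV : (z^-1 = z)%g.
  by apply/set1P; rewrite -S1z inE BV //= expgVn zp invg1.
have zz : (z * z = 1)%g by rewrite -{1}zV mulVg.
have p2 : p = 2%N.
  case: (even_prime p_pr) => // p_odd; move: zp z1.
  rewrite -(odd_double_half p) p_odd expgD expg1 -mul2n expgM (expgS z 1) expg1.
  by rewrite zz expg1n mulg1 => ->; rewrite eqxx.
(* The square roots of y^2 in Q are y and yz, and an even number of them lies in B. *)
have Bz y : y \in B -> y != z -> (y * z)%g \in B.
  move=> yB yz; have yQ := subsetP sBQ _ yB; apply/negPn/negP=> yzB.
  have y2 : (y ^+ p != 1)%g.
    apply: contra yz => yp; apply/eqP/set1P; by rewrite -S1z inE yB.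
  have := aP _ (groupX p yQ); rewrite (negPf y2).
  rewrite (_ : [set _ in _ | _] = [set y]) ?cards1 => [/eqP|].
    by rewrite oner_eq0.
  apply/setP=> u; rewrite !inE.
  apply/andP/eqP=> [[uB /eqP uy]|->]; last by rewrite eqxx.
  have uQ := subsetP sBQ _ uB.
  have : (y^-1 * u)%g \in [set 1%g; z].
    have : [set 1%g; z] == [set v in Q | v ^+ p == 1]%g.
      rewrite eqEcard cards2 eq_sym z1 andbC.
      have := cyclic_card_roots (ltnW p_gt1); rewrite {2}p2 => -> /=.
      by apply/subsetP=> v; rewrite !inE => /orP[]/eqP->; rewrite ?zp ?expg1n eqxx ?group1 ?zQ.
    move/eqP=> ->; rewrite inE groupM ?groupV //= expgMn.
      by rewrite uy expgVn mulVg.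
    by apply: (centsP abQ); rewrite ?groupV.
  rewrite !inE => /orP[]/eqP yu; last by rewrite -yu mulKVg uB in yzB.
  by rewrite -(mulKVg y u) yu mulg1.
(* At z the term y = z contributes 0, as 1 is not in B, and every other y contributes 1. *)
have := convB zQ; rewrite zB (negPf z1) mulr0 addr0 mulr1.
rewrite (big_setD1 z) //= mulVg (negPf B1) add0r.
rewrite (eq_bigr (fun=> 1)) => [|y /setD1P[yz yB]]; last first.
  rewrite Bz ?BV //; apply: contra yz => /eqP yV.
  by rewrite -(invgK y) yV zV.
rewrite sumr_const => h2.
have h3 : c + (2 - e) = #|B|%:R - 1 by rewrite -h2 (cardsD1 z B) zB add1n -natr1 addrK.
have [e2 /eqP] := counting_translate h1 hT h3.
rewrite mulf_eq0 => /orP[].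
  by rewrite subr_eq0 (eqr_nat int _ 1) => /eqP.
rewrite subr_eq0 natr1 (eqr_nat int).
by move: BQ2; clear; lia.
Qed.
End Involution.

(** * The subgroup of periods *)

(** The coefficient at [u] of M = X + X^(-1) in the group ring. *)
Definition sym_ind (gT : finGroupType) (X : {set gT}) (u : gT) : int :=
  ([ind u in X] + [ind u^-1%g in X])%R.

Section SymmetricPart.
Local Open Scope ring_scope.
Variables (gT : finGroupType) (C : {group gT}) (X : {set gT}) (m d : int).
Hypotheses (abC : abelian C) (sXC : X \subset C).
Hypothesis convX : forall g, g \in C ->
  \sum_(y in X) sym_ind X (y^-1 * g)%g = m - d * [ind g in X].

Lemma sym_indV u : sym_ind X u^-1%g = sym_ind X u.
Proof. by rewrite /sym_ind invgK addrC. Qed.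

Lemma sum_ind (A : {set gT}) (F : gT -> int) : A \subset C ->
  \sum_(y in C) [ind y in A] * F y = \sum_(y in A) F y.
Proof.
move=> sAC; rewrite [LHS]big_mkcond [RHS]big_mkcond; apply: eq_bigr => y _.
have [yA|yA] := boolP (y \in A); first by rewrite (subsetP sAC) // mul1r.
by rewrite mul0r if_same.
Qed.

(** Split the first factor as X + X^(-1). The X half is [convX] at g; as M is symmetric, inverting y
    turns the other half into [convX] at g^-1. *)
Lemma conv_sym g : g \in C ->
  \sum_(y in C) sym_ind X y * sym_ind X (y^-1 * g)%g = 2 * m - d * sym_ind X g.
Proof.
move=> gC; under eq_bigr => y yC do rewrite {1}/sym_ind mulrDl.
rewrite big_split /= sum_ind // convX // [X in _ + X](reindex_inj invg_inj) /=.
under eq_bigl => y do rewrite groupV.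
rewrite (eq_bigr (fun y => [ind y in X] * sym_ind X (y^-1 * g^-1)%g)); last first.
  move=> y yC; rewrite !invgK -[sym_ind X (y * g)%g]sym_indV invMg.
  by rewrite (centsP abC g^-1%g) ?groupV.
by rewrite sum_ind // convX ?groupV // /sym_ind; ring.
Qed.

End SymmetricPart.

(** * The case where M vanishes only at the identity *)

Section Reduced.
Local Open Scope ring_scope.
Variables (gT : finGroupType) (Q : {group gT}) (Y : {set gT}) (m d : int).
Hypotheses (cQ : cyclic Q) (sYQ : Y \subset Q).
Hypothesis convY : forall q, q \in Q ->
  \sum_(y in Y) sym_ind Y (y^-1 * q)%g = m - d * [ind q in Y].
Hypotheses (Y1 : 1%g \notin Y) (Y0 : Y != set0) (mY : m < (2 * #|Y|)%:R).
Hypothesis coverY : forall q, q \in Q -> q != 1%g -> (q \in Y) || (q^-1 \in Y)%g.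

Let B := Y :&: Y^-1%g.

Lemma sym_ind_reduced q : q \in Q ->
  sym_ind Y q = 1 - (q == 1%g)%:R + [ind q in B].
Proof.
move=> qQ; rewrite /sym_ind !inE.
have [->|q1] := eqVneq q 1%g; first by rewrite invg1 (negPf Y1).
by have := coverY qQ q1; case: (q \in Y); case: (q^-1 \in Y)%g.
Qed.

Lemma sub_symmetric_core : B \subset Q.
Proof. by apply: subset_trans sYQ; apply: subsetIl. Qed.

(** Substitute M = Q - 1 + B into M^2 = 2 m Q - d M; products with Q are multiples of Q and go into
    the constant. *)
Lemma conv_symmetric_core q : q \in Q ->
  \sum_(y in B) [ind (y^-1 * q)%g in B] =
    (2 * m - #|Q|%:R - 2 * #|B|%:R + 2 - d)
      + (2 - d) * [ind q in B] + (d - 1) * (q == 1%g)%:R.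
Proof.
move=> qQ; have := conv_sym (cyclic_abelian cQ) sYQ convY qQ.
rewrite sym_ind_reduced //.
pose f y : int := 1 - (y == 1%g)%:R + [ind y in B].
rewrite (eq_bigr (fun y => f y + ([ind (y^-1 * q)%g in B]
   - (y == 1%g)%:R * [ind (y^-1 * q)%g in B]
   + [ind y in B] * [ind (y^-1 * q)%g in B]) - (y == q)%:R * f q)); last first.
  move=> y yQ; rewrite !sym_ind_reduced ?groupM ?groupV // /f.
  rewrite -eq_mulVg1; have [->|yq] := eqVneq y q; rewrite ?mulVg ?mulr1n ?mulr0n; ring.
have sB (F : gT -> int) : \sum_(y in Q) [ind y in B] * F y = \sum_(y in B) F y.
  exact/sum_ind/sub_symmetric_core.
have s1 (u : gT) (F : gT -> int) : u \in Q ->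
    \sum_(y in Q) (y == u)%:R * F y = F u.
  move=> uQ; rewrite (bigD1 u) //= eqxx mul1r big1 ?addr0 // => y /andP[_ /negPf->].
  by rewrite mul0r.
have sQ : \sum_(y in Q) [ind (y^-1 * q)%g in B] = #|B|%:R :> int.
  rewrite (reindex_inj (mulgI q)) /= (reindex_inj invg_inj) /=.
  rewrite -sumr_const -(sB (fun=> 1)); apply: eq_big => y; first by rewrite groupMl ?groupV.
  by rewrite invMg invgK mulgKV /= mulr1.
rewrite sumrB !big_split /= !sumrN sB sQ !s1 ?group1 // invg1 mul1g.
rewrite sumr_const; have /= := sB (fun=> 1); rewrite sumr_const.
under eq_bigr => y _ do rewrite mulr1; move=> ->.
have /= := s1 1%g (fun=> 1) (group1 Q).
under eq_bigr => y _ do rewrite mulr1; move=> ->.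
rewrite /f; move: (\sum_(y in B) _) => s h.
have -> : s = (#|Q|%:R - 1 + #|B|%:R + (#|B|%:R - [ind q in B] + s) -
   (1 - (q == 1%g)%:R + [ind q in B])) - #|Q|%:R - 2 * #|B|%:R
   + 2 - (q == 1%g)%:R + 2 * [ind q in B] by ring.
rewrite h; ring.
Qed.

(** Otherwise Y is closed under inversion and [convY] at 1 reads 2|Y| = m, contrary to [mY]. *)
Lemma reduced_proper : exists q0, [/\ q0 \in Q, q0 != 1%g & q0 \notin B].
Proof.
have [sQB|/subsetPn[q]] := boolP (Q :\ 1%g \subset B); last first.
  by rewrite !inE => /andP[q1 qQ] qB; exists q; split=> //; rewrite !inE.
have YV y : y \in Y -> (y^-1)%g \in Y.
  move=> yY; suff: y \in B by rewrite !inE => /andP[].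
  by apply: (subsetP sQB); rewrite !inE (subsetP sYQ) // andbT; apply: contraNneq Y1 => <-.
have := convY (group1 Q); rewrite (negPf Y1) mulr0 subr0 (eq_bigr (fun=> 2)).
  by rewrite sumr_const => h; move: mY; rewrite -h -mulrnA ltxx.
by move=> y yY; rewrite /sym_ind mulg1 invgK yY YV.
Qed.

Lemma reduced_structure :
  (d = 1 /\ forall y, y \in Y -> (y^-1)%g \notin Y) \/
  (d = 2 /\ exists z, [/\ (z * z = 1)%g, B = [set z], (2 < #|Q|)%N
     & forall q, q \in Q -> (q \in Y) || (z^-1 * q \in Y)%g]).
Proof.
have [Be|B0] := eqVneq B set0.
  left; split=> [|y yY]; last first.
    by apply/negP=> yV; have := in_set0 y; rewrite -Be !inE yY yV.
  (* With B empty its convolution is 0; comparing the coefficients at y and at 1 gives d = 1. *)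
  have [y yY] := set0Pn _ Y0.
  have y1 : y != 1%g by apply: contraNneq Y1 => <-.
  have := conv_symmetric_core (subsetP sYQ _ yY); have := conv_symmetric_core (group1 Q).
  rewrite Be !big_set0 !inE eqxx (negPf y1) !mulr0 !addr0 mulr1.
  by move=> + h; rewrite -h add0r => /eqP; rewrite eq_sym subr_eq0 => /eqP.
have [q0 [q0Q q01 q0B]] := reduced_proper.
have B1 : 1%g \notin B by rewrite inE negb_and Y1.
have BV y : y \in B -> y^-1%g \in B by rewrite !inE invgK andbC.
have [z [Bz zz d2]] := two_eigenvalue_involution cQ sub_symmetric_core
  conv_symmetric_core B1 BV B0 q0Q q01 q0B.
right; split=> //; exists z.
have zB : z \in B by rewrite Bz set11.
have zQ := subsetP sub_symmetric_core _ zB.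
have z1 : z != 1%g by apply: contraNneq B1 => <-.
have zV : (z^-1 = z)%g by apply/eqP; rewrite eq_invg_mul zz.
split=> //.
  rewrite (cardsD1 1%g) (cardsD1 z) (cardsD1 q0) !inE group1 z1 zQ q01 q0Q.
  by have /negPf-> : q0 != z by apply: contraNneq q0B => ->.
(* With M = Q - 1 + z and d = 2, the identity Y M = m Q - 2 Y becomes Y + zY = (m - |Y|) Q. *)
have YE q : q \in Q -> [ind q in Y] + [ind (z^-1 * q)%g in Y] = m - #|Y|%:R :> int.
  move=> qQ; have := convY qQ; rewrite d2.
  rewrite (eq_bigr (fun y => 1 - (y == q)%:R + (y == z^-1 * q)%g%:R)); last first.
    move=> y yY; have yQ := subsetP sYQ _ yY.
    rewrite sym_ind_reduced ?groupM ?groupV // -eq_mulVg1; congr (_ + _%:R).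
    rewrite Bz inE -(inj_eq (mulgI y)) mulKVg (centsP (cyclic_abelian cQ) y) //.
    by rewrite -(inj_eq (mulgI z^-1)%g) mulKg eq_sym.
  rewrite !big_split /= sumrN sumr_const.
  have sE u : \sum_(y in Y) (y == u)%:R = [ind u in Y] :> int.
    have [uY|uY] := boolP (u \in Y).
      by rewrite (bigD1 u) //= eqxx big1 ?addr0 // => y /andP[_ /negPf->].
    by rewrite big1 // => y yY; have /negPf-> : y != u by apply: contraNneq uY => <-.
  by rewrite !sE; lra.
(* The constant is 1 by its value at the identity: 1 is not in Y, but z is. *)
move=> q qQ; have := YE q qQ; rewrite -(YE 1%g (group1 Q)) mulg1 (negPf Y1) zV.
by have := zB; rewrite !inE => /andP[-> _]; case: (q \in Y); case: (z * q \in Y)%g.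
Qed.

End Reduced.

(** * Periods of M and passage to the quotient *)

Section Structure.
Local Open Scope ring_scope.
Variables (gT : finGroupType) (C : {group gT}) (X : {set gT}) (m d : int).
Hypotheses (cC : cyclic C) (sXC : X \subset C).
Hypothesis convX : forall g, g \in C ->
  \sum_(y in X) sym_ind X (y^-1 * g)%g = m - d * [ind g in X].
Hypotheses (X1 : 1%g \notin X) (X0 : X != set0) (mX : m < (2 * #|X|)%:R).

Let abC : abelian C := cyclic_abelian cC.

Lemma sym_ind1 : sym_ind X 1%g = 0.
Proof. by rewrite /sym_ind invg1 (negPf X1). Qed.

Lemma sym_ind_ge0 u : 0 <= sym_ind X u.
Proof. by rewrite addr_ge0. Qed.

(** Each family of squares sums to the coefficient of M^2 at 1, which is 2m since M(1) = 0;
    [conv_sym] gives the cross terms. *)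
Lemma sum_sqr_sym g : g \in C ->
  \sum_(y in C) (sym_ind X y - sym_ind X (y^-1 * g)%g) ^+ 2 = 2 * (d * sym_ind X g).
Proof.
move=> gC; have conv := conv_sym abC sXC convX.
have := conv _ (group1 C); rewrite sym_ind1 mulr0 subr0.
under eq_bigr => y _ do rewrite mulg1 sym_indV; move=> sq.
have sq' : \sum_(y in C) sym_ind X (y^-1 * g)%g * sym_ind X (y^-1 * g)%g = 2 * m.
  rewrite -sq (reindex_inj (mulgI g)) /= (reindex_inj invg_inj) /=.
  apply: eq_big => y; first by rewrite groupMl ?groupV.
  by rewrite invMg invgK mulgKV.
rewrite (eq_bigr (fun y => sym_ind X y * sym_ind X y
   + sym_ind X (y^-1 * g)%g * sym_ind X (y^-1 * g)%g
   - 2 * (sym_ind X y * sym_ind X (y^-1 * g)%g))); last by move=> y _; ring.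
by rewrite sumrB big_split /= sq sq' -mulr_sumr conv //; ring.
Qed.

Lemma sym_ind_refl g : g \in C -> d * sym_ind X g <= 0 ->
  forall y, y \in C -> sym_ind X y = sym_ind X (y^-1 * g)%g.
Proof.
move=> gC le0 y yC; apply/eqP; rewrite -subr_eq0 -sqrf_eq0; apply/eqP.
pose F u : int := (sym_ind X u - sym_ind X (u^-1 * g)%g) ^+ 2.
apply: (@psumr_eq0P _ _ (mem C) F) yC => [u _|]; first exact: sqr_ge0.
apply/eqP; rewrite eq_le sumr_ge0 ?andbT => [|u _]; last exact: sqr_ge0.
by rewrite sum_sqr_sym // pmulr_rle0.
Qed.

(** For d at most 0, reflection at g in X would give M(g) = M(1) = 0. *)
Lemma gap_gt0 : 0 < d.
Proof.
have [g gX] := set0Pn _ X0; have gC := subsetP sXC _ gX.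
rewrite ltNge; apply/negP => d0.
have := sym_ind_refl gC (mulr_le0_ge0 d0 (sym_ind_ge0 g)) gC.
by rewrite mulVg sym_ind1 /sym_ind gX; case: (g^-1 \in X)%g.
Qed.

(** The reflection of y into y^-1 g, combined with the symmetry of M, is translation by g. *)
Lemma sym_ind_periodic g y : g \in C -> sym_ind X g = 0 -> y \in C ->
  sym_ind X (y * g)%g = sym_ind X y.
Proof.
move=> gC g0 yC; rewrite -[RHS]sym_indV [RHS](sym_ind_refl gC) ?groupV ?invgK //.
by rewrite g0 mulr0.
Qed.

Definition zero_set := [set g in C | sym_ind X g == 0].

Lemma null_set_group : group_set zero_set.
Proof.
apply/group_setP; split=> [|g h]; first by rewrite inE group1 sym_ind1 eqxx.
rewrite !inE => /andP[gC /eqP g0] /andP[hC /eqP h0].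
by rewrite groupM // sym_ind_periodic ?g0 ?eqxx.
Qed.

Let H := Group null_set_group.

Lemma null_subset : H \subset C.
Proof. by apply/subsetP=> g; rewrite inE => /andP[]. Qed.

(** Translation by h preserves M, hence the left side of [convX]; since d is nonzero, the indicator
    of X is preserved too. *)
Lemma null_periodic g h : g \in C -> h \in H -> ((g * h)%g \in X) = (g \in X).
Proof.
move=> gC; rewrite inE => /andP[hC /eqP h0].
have := convX (groupM gC hC); rewrite (eq_bigr (fun y => sym_ind X (y^-1 * g)%g)).
  rewrite convX // => /addrI/oppr_inj/(mulfI (lt0r_neq0 gap_gt0))/eqP.
  by rewrite (eqr_nat int); case: (_ \in X); case: (_ \in X).
move=> y yX; rewrite mulgA sym_ind_periodic // groupM ?groupV //.
exact: (subsetP sXC).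
Qed.

Lemma null_norm : C \subset 'N(H).
Proof. exact: sub_abelian_norm abC null_subset. Qed.

Lemma mem_quotient_null u : u \in X -> coset H u \in (X / H)%g.
Proof.
by move=> uX; rewrite mem_morphim ?(subsetP null_norm) ?(subsetP sXC).
Qed.

Lemma mem_coset_null u : u \in C -> (coset H u \in (X / H)%g) = (u \in X).
Proof.
move=> uC; apply/idP/idP=> [|]; last exact: mem_quotient_null.
case/morphimP=> v vN vX E; have vC := subsetP sXC _ vX.
have : u \in (H :* v)%g.
  by apply/rcoset_kercosetP => //; apply: (subsetP null_norm).
case/rcosetP=> h hH ->; rewrite (centsP abC h) ?(subsetP null_subset h) //.
by rewrite null_periodic.
Qed.

Lemma sum_coset_null (F : coset_of H -> int) :
  \sum_(g in X) F (coset H g) = #|H|%:R * \sum_(q in (X / H)%g) F q.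
Proof.
rewrite (partition_big (coset H) (fun q => q \in (X / H)%g)); last first.
  exact: mem_quotient_null.
rewrite mulr_sumr; apply: eq_bigr => q /morphimP[u uN uX ->].
have uC := subsetP sXC _ uX.
rewrite (eq_bigr (fun=> F (coset H u))) => [|g /andP[_ /eqP->] //].
rewrite (eq_bigl (fun g => g \in (H :* u)%g)) ?sumr_const ?card_rcoset ?mulr_natl //.
move=> g; apply/andP/idP=> [[gX /eqP E]|gH].
  by apply/rcoset_kercosetP => //; apply: (subsetP null_norm); apply: (subsetP sXC).
have gC : g \in C.
  by case/rcosetP: gH => h hH ->; rewrite groupM // (subsetP null_subset).
have E : coset H g = coset H u.
  by apply/rcoset_kercosetP => //; apply: (subsetP null_norm).
by rewrite E eqxx -mem_coset_null // E mem_quotient_null.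
Qed.

Lemma card_quotient_null : #|X| = (#|H| * #|(X / H)%g|)%N.
Proof.
apply/eqP; rewrite -(eqr_nat int) natrM.
by have := sum_coset_null (fun=> 1); rewrite !sumr_const => ->.
Qed.

Lemma sym_ind_quotient u : u \in C ->
  sym_ind (X / H)%g (coset H u) = sym_ind X u.
Proof.
move=> uC; rewrite /sym_ind -morphV ?(subsetP null_norm) //=.
by rewrite !mem_coset_null ?groupV.
Qed.

(** This pulls [reduced_structure] for X / H back to C. The bound on 2|H| says that C / H has more
    than two elements. *)
Lemma period_structure : exists H : {group gT}, [/\ H \subset C,
    forall g, g \in C -> (g \in H) = ~~ ((g \in X) || (g^-1 \in X)%g),
    forall g h, g \in C -> h \in H -> ((g * h)%g \in X) = (g \in X)
  & exists d' : int, d = #|H|%:R * d' /\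
    ((d' = 1 /\ forall y, y \in X -> (y^-1)%g \notin X) \/
    (d' = 2 /\ exists z, [/\ z \in C, (z * z)%g \in H,
      (forall g, g \in C -> (g \in X) && (g^-1 \in X)%g = (coset H g == coset H z)),
      (2 * #|H| < #|C|)%N
      & forall g, g \in C -> (g \in X) || (z^-1 * g \in X)%g]))].
Proof.
exists H; split; [exact: null_subset| |exact: null_periodic|].
  by move=> g gC; rewrite inE gC /sym_ind; case: (g \in X); case: (g^-1 \in X)%g.
pose Y := (X / H)%g; pose Q := (C / H)%G.
have nCH g : g \in C -> g \in 'N(H) by apply: (subsetP null_norm).
have h_gt0 : 0 < #|H|%:R :> int by rewrite ltr0n cardG_gt0.
have h_neq0 := lt0r_neq0 h_gt0.
have sYQ : Y \subset Q by apply: morphimS.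
have Qcoset q : q \in Q -> exists2 g, g \in C & q = coset H g.
  by case/morphimP=> g _ gC ->; exists g.
have Y1 : 1%g \notin Y by rewrite -(morph1 (coset H)) mem_coset_null.
have convY q : q \in Q ->
    #|H|%:R * (\sum_(y in Y) sym_ind Y (y^-1 * q)%g) = m - d * [ind q in Y].
  case/Qcoset=> g gC ->; rewrite mem_coset_null // -convX // -sum_coset_null.
  apply: eq_bigr => v vX; have vC := subsetP sXC _ vX.
  rewrite -morphV ?nCH //= -morphM ?groupV ?nCH //=.
  by rewrite sym_ind_quotient ?groupM ?groupV.
have Y0 : Y != set0.
  by have [g gX] := set0Pn _ X0; apply/set0Pn; exists (coset H g); apply: mem_quotient_null.
have [y yY] := set0Pn _ Y0.
(* Evaluation at 1 and at y shows that |H| divides m and m - d, hence d. *)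
have := convY _ (group1 Q); rewrite (negPf Y1) mulr0 subr0.
set m' := \sum_(i in Y) _ => mE.
have := convY _ (subsetP sYQ _ yY); rewrite yY mulr1 -mE.
set s := \sum_(i in Y) _ => dE.
pose d' := m' - s; have {}dE : d = #|H|%:R * d' by rewrite /d' mulrBr dE; ring.
exists d'; split=> //.
have convY' q : q \in Q ->
    \sum_(y in Y) sym_ind Y (y^-1 * q)%g = m' - d' * [ind q in Y].
  by move=> qQ; apply: (mulfI h_neq0); rewrite convY // -mE dE; ring.
have mY : m' < (2 * #|Y|)%:R.
  by move: mX; rewrite card_quotient_null -mE mulnCA natrM ltr_pM2l.
have covY q : q \in Q -> q != 1%g -> (q \in Y) || (q^-1 \in Y)%g.
  case/Qcoset=> g gC -> g1; rewrite -morphV ?nCH //= !mem_coset_null ?groupV //.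
  apply: contraNT g1; rewrite negb_or => /andP[gX gVX]; apply/eqP/coset_id.
  by rewrite inE gC /sym_ind (negPf gX) (negPf gVX).
have [] := reduced_structure (quotient_cyclic H cC) sYQ convY' Y1 Y0 mY covY.
  case=> d1 dis; left; split=> // v vX; have vC := subsetP sXC _ vX.
  rewrite -mem_coset_null ?groupV // morphV ?nCH //=.
  by apply: dis; rewrite mem_quotient_null.
case=> d2 [_z [zz Bz Q2 cov]]; right; split=> //.
have zQ : _z \in Q.
  by apply: (subsetP sYQ); have := set11 _z; rewrite -Bz inE => /andP[].
have [z zC zE] := Qcoset _ zQ; rewrite {_z}zE in zz Bz cov zQ.
exists z; split=> //.
- by apply: coset_idr; rewrite ?groupM ?nCH // morphM ?nCH.
- move=> g gC; have := congr1 (fun A : {set _} => coset H g \in A) Bz.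
  by rewrite /= !inE -morphV ?nCH //= !mem_coset_null ?groupV.
- rewrite -(Lagrange null_subset) mulnC ltn_pmul2l ?cardG_gt0 //.
  by rewrite -card_quotient // null_norm.
- move=> g gC; have := cov (coset H g) (mem_quotient H gC).
  by rewrite -morphV ?nCH //= -morphM ?groupV ?nCH //= !mem_coset_null ?groupM ?groupV.
Qed.

End Structure.

(** * The conditions (a) and (b) *)

Section CyclicConditions.
Local Open Scope ring_scope.
Variables (gT : finGroupType) (x : gT).
Implicit Types (X : {set gT}) (v w : nat).

Lemma mem_cycleX v j : (v %| #[x])%N -> ((x ^+ j)%g \in <[x ^+ v]>%g) = (v %| j)%N.
Proof.
move=> vn; apply/idP/idP=> [/cycleP[k /eqP]|/dvdnP[k ->]]; last first.
  by rewrite mulnC expgM mem_cycle.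
rewrite -expgM eq_expg_mod_order => /eqP E.
by rewrite /dvdn -(modn_dvdm j vn) E modn_dvdm // modnMr.
Qed.

Lemma cyclic_subgroup_eq (H : {group gT}) :
  H \subset <[x]> -> H :=: <[x ^+ #|<[x]> : H|]>%g.
Proof.
move=> sH; have iL := Lagrange sH; have dn := dvdn_indexg <[x]>%G H.
apply/eqP; rewrite (eq_subG_cyclic (cycle_cyclic x)) ?cycleX //.
rewrite -[#|<[_ ^+ _]>%g|]/#[_] orderXdiv // -[X in X == _](mulnK _ (indexg_gt0 <[x]> H)).
by rewrite iL.
Qed.

Lemma periodic_decomposition X v : (0 < v)%N -> X \subset <[x]>%g -> 1%g \notin X ->
    (forall g h, g \in <[x]>%g -> h \in <[x ^+ v]>%g -> ((g * h)%g \in X) = (g \in X)) ->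
  X = ((X :&: powers_lt x v) * <[x ^+ v]>)%g.
Proof.
move=> v0 sX X1 per; apply/setP=> g; apply/idP/mulsgP=> [gX|[y h]]; last first.
  rewrite inE => /andP[yX _] hH ->.
  by rewrite per // (subsetP sX).
have /cycleP[i gi] := subsetP sX _ gX.
have E : g = (x ^+ (i %% v) * (x ^+ v) ^+ (i %/ v))%g.
  by rewrite gi {1}(divn_eq i v) addnC expgD mulnC expgM.
have rX : (x ^+ (i %% v) \in X)%g.
  by rewrite -(per _ ((x ^+ v) ^+ (i %/ v))%g) ?mem_cycle // -E.
exists (x ^+ (i %% v))%g ((x ^+ v) ^+ (i %/ v))%g; rewrite ?mem_cycle //.
rewrite inE rX; apply/imsetP; exists (Ordinal (ltn_pmod i v0)) => //=.
(* Residue 0 would put 1 into X. *)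
rewrite inE /= lt0n; apply: contra X1 => /eqP r0.
by rewrite r0 expg0 in rX.
Qed.

Lemma conditions_of_conv X (m d : int) :
    X \subset (<[x]> :\ 1)%g -> X != set0 -> m < (2 * #|X|)%:R ->
    (forall g, g \in <[x]>%g ->
      \sum_(y in X) sym_ind X (y^-1 * g)%g = m - d * [ind g in X]) ->
  dih_cond_a #[x] x X d \/ dih_cond_b #[x] x X d.
Proof.
rewrite subsetD1 => /andP[sX X1] X0 mX convX.
have cC := cycle_cyclic x.
have [H [sH XHE per gap]] := period_structure cC sX convX X1 X0 mX.
have nCH g : g \in <[x]>%g -> g \in 'N(H).
  by apply/subsetP/(sub_abelian_norm (cycle_abelian x)).
have [w wE] : exists w, w = #|<[x]> : H| by exists #|<[x]>%g : H|.
have Hw : H :=: <[x ^+ w]>%g by rewrite wE; apply: cyclic_subgroup_eq.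
have nE : (#|H| * w)%N = #[x] by rewrite wE Lagrange.
have wn : (w %| #[x])%N by rewrite -nE dvdn_mull.
have w0 : (0 < w)%N by rewrite wE indexg_gt0.
have XC g : g \in X -> g \in <[x]>%g by apply: (subsetP sX).
have XVC g : (g^-1)%g \in X -> g \in <[x]>%g by move/XC; rewrite groupV.
have [d' [dE [[d1 dis]|[d2 [z [zC zz BE H2 cov]]]]]] := gap.
  left; exists w; split.
  (* For w = 1 the group H would be all of <x>, while it misses the nonempty set X. *)
  - rewrite ltn_neqAle w0 andbT; apply: contraTneq X0 => w1; apply/set0Pn=> -[g gX].
    by move: (XHE g (XC g gX)); rewrite gX Hw -w1 expg1 XC.
  - by rewrite dE d1 mulr1 mulrC -nE PoszM natz.
  exists (X :&: powers_lt x w); rewrite -Hw; split=> //.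
  - by rewrite subsetIr.
  - by rewrite Hw; apply: periodic_decomposition => // g h gC; rewrite -Hw; apply: per.
  - apply/setP=> g; rewrite !inE; have [gC|gC] := boolP (g \in <[x]>%g).
      by rewrite XHE // negbK andbT.
    rewrite andbF; apply/negbTE; rewrite negb_or.
    by rewrite (contraNN (@XC g)) ?(contraNN (@XVC g)).
  - rewrite -setI_eq0; apply/eqP/setP=> g; rewrite !inE; apply/andP=> [[gX]].
    exact/negP/dis.
have zH : z \notin H.
  apply/negP=> zH; have := BE 1%g (group1 _).
  by rewrite (negPf X1) morph1 coset_id // eqxx.
(* For z = x^i, w divides 2i but not i. So w = 2v is even, i is an odd multiple of v, and z lies in
   x^v H. *)
have /cycleP[i zi] := zC.
have w2i : (w %| i.*2)%N by rewrite -mem_cycleX // -Hw -addnn expgD -zi.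
have wi : ~~ (w %| i)%N by rewrite -mem_cycleX // -Hw -zi.
have wd : ~~ odd w.
  by apply: contra wi => ow; move: w2i; rewrite -mul2n Gauss_dvdr // coprimen2.
have [v wv] : exists v, w = v.*2 by exists w./2; rewrite -[LHS]odd_double_half (negPf wd).
have zv : coset H z = coset H (x ^+ v)%g.
  have vi : (v %| i)%N by move: w2i; rewrite wv -!muln2 dvdn_pmul2r.
  have /dvdnP[k ik] := vi.
  have ok : odd k.
    apply: contraNT wi => ek; rewrite ik wv -[k]odd_double_half (negPf ek) add0n.
    by rewrite -!mul2n -mulnA mulnCA dvdn_mull // mul2n dvdnn.
  rewrite zi ik -[k]odd_double_half ok mulnDl mul1n expgD -muln2 -mulnA mul2n -wv.
  rewrite mulnC morphM ?nCH ?mem_cycle //= [X in (_ * X)%g]coset_id ?mulg1 //.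
  by rewrite Hw expgM mem_cycle.
have xvE g : g \in <[x]>%g -> (g \in (x ^+ v *: H))%g = (coset H g == coset H z).
  move=> gC; rewrite zv; apply/lcosetP/eqP=> [[h hH ->]|E].
    rewrite morphM ?nCH ?mem_cycle ?(subsetP sH) //= [X in (_ * X)%g]coset_id //.
    by rewrite mulg1.
  exists ((x ^+ v)^-1 * g)%g; last by rewrite mulKVg.
  apply: coset_idr; rewrite ?nCH ?groupM ?groupV ?mem_cycle //.
  by rewrite morphM ?morphV ?nCH ?groupV ?mem_cycle //= E mulVg.
right; exists v; rewrite -wv; split=> //.
- move: H2; rewrite -[#|<[x]>%g|]/#[x] -nE mulnC ltn_pmul2l ?cardG_gt0 // wv.
  by rewrite -muln2 -(mul1n 2%N) ltn_pmul2r.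
- by rewrite dE d2 -nE wv -muln2 !PoszM natz mulrC -mulrA (mulrC 2).
exists (X :&: powers_lt x w); rewrite -Hw; split=> //.
- by rewrite subsetIr.
- by rewrite Hw; apply: periodic_decomposition => // g h gC; rewrite -Hw; apply: per.
- apply/ffunP=> g; rewrite !ffunE !inE; have [gC|gC] := boolP (g \in <[x]>%g).
    rewrite xvE // -BE // XHE // negbK andbT.
    by case: (g \in X); case: (g^-1 \in X)%g.
  rewrite andbF (negPf (contraNN (@XC g) gC)) (negPf (contraNN (@XVC g) gC)).
  rewrite (_ : g \in _ = false) //; apply: contraNF gC => /lcosetP[h hH ->].
  by rewrite groupM ?mem_cycle // (subsetP sH).
apply/setP=> g; rewrite !inE; apply/orP/idP=> [[/XC //|]|gC].
  by case/lcosetP=> y /XC yC ->; rewrite groupM ?mem_cycle.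
have /orP[|zg] := cov g gC; [by left|right].
apply/lcosetP; exists ((x ^+ v)^-1 * g)%g; last by rewrite mulKVg.
(* Translation by z, as in [cov], differs from translation by x^v by an element of H, a period of
   X. *)
have: (z^-1 * x ^+ v)%g \in H.
  apply: coset_idr; rewrite ?nCH ?groupM ?groupV ?mem_cycle //.
  by rewrite morphM ?morphV ?nCH ?groupV ?mem_cycle //= zv mulVg.
move=> hH; rewrite -(per _ (z^-1 * x ^+ v)%g) // ?groupM ?groupV ?mem_cycle //.
rewrite (centsP (cycle_abelian x) _ _ (z^-1 * x ^+ v)%g) ?groupM ?groupV ?mem_cycle //.
by rewrite mulgA mulgK.
Qed.

End CyclicConditions.

(** * From the conditions back to the convolution identity *)

Section ConverseConditions.
Local Open Scope ring_scope.
Variables (gT : finGroupType).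
Implicit Types (X T : {set gT}) (H C : {group gT}).

Lemma periodic_mulG T H X g h : X = (T * H)%g -> h \in H -> ((g * h)%g \in X) = (g \in X).
Proof.
move=> XE; have gh u k : u \in X -> k \in H -> (u * k)%g \in X.
  by rewrite XE => /mulsgP[t l tT lH ->] kH; rewrite -mulgA mem_mulg ?groupM.
move=> hH; apply/idP/idP=> [ghX|gX]; last exact: gh.
by rewrite -(mulgK h g) gh ?groupV.
Qed.

(** This is X H = |H| X in the group ring: y^-1 g lies in H exactly when y lies in g H. *)
Lemma count_periodic X H g :
    (forall u h, u \in X -> h \in H -> (u * h)%g \in X) ->
  \sum_(y in X) [ind (y^-1 * g)%g in H] = #|H|%:R * [ind g in X] :> int.
Proof.
move=> per; have [gX|gX] := boolP (g \in X); last first.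
  rewrite mulr0 big1 // => y yX; case: (boolP (y^-1 * g \in H)%g) => // yg.
  by case/negP: gX; rewrite -(mulKVg y g) per.
have sub : (g *: H)%g \subset X.
  by apply/subsetP=> y /lcosetP[h hH ->]; apply: per.
rewrite mulr1 -(card_lcoset H g) -sum1_card natr_sum [LHS]big_mkcond [RHS]big_mkcond.
apply: eq_bigr => y _; rewrite -groupV invMg invgK -mem_lcoset.
have [yH|yH] := boolP (y \in (g *: H)%g); last by rewrite if_same.
by rewrite (subsetP sub).
Qed.

End ConverseConditions.

Section ConvOfConditions.
Local Open Scope ring_scope.
Variables (gT : finGroupType) (x : gT) (X : {set gT}) (d : int).
Hypotheses (sX1 : X \subset (<[x]> :\ 1)%g).

Let sX : X \subset <[x]>%g.
Proof. by move: sX1; rewrite subsetD1 => /andP[]. Qed.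

Let conv_conclusion := exists mu la : nat, [/\ mu%:Z - la%:Z = d,
  (0 < mu < 2 * #|X|)%N
  & forall g, g \in <[x]>%g ->
      \sum_(y in X) sym_ind X (y^-1 * g)%g = mu%:Z - d * [ind g in X]].

(** Here M = C - H, so X M = |X| C - |H| X; hence mu = |X| and d = |H|. *)
Lemma conv_of_cond_a : dih_cond_a #[x] x X d -> conv_conclusion.
Proof.
case=> v [v1 vd [T [_ XE UE dis]]].
have vn : (v %| #[x])%N.
  have : (v%:Z %| #[x]%:Z)%Z by rewrite -vd dvdz_mulr.
  by rewrite dvdzE.
have dE : d = (#[x] %/ v)%N%:Z.
  have v0 : v%:Z != 0 by rewrite -lt0n (ltnW v1).
  by apply: (mulfI v0); rewrite vd -PoszM; congr Posz; rewrite mulnC divnK.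
set H := <[x ^+ v]>%G; have hE : #|H| = (#[x] %/ v)%N.
  by rewrite -[#|_|]/#[(x ^+ v)%g] orderXdiv.
have per u h : u \in X -> h \in H -> (u * h)%g \in X.
  by move=> uX hH; rewrite (periodic_mulG _ XE).
have symE u : u \in <[x]>%g -> sym_ind X u = 1 - [ind u in H].
  move=> uC; have := congr1 (fun A : {set gT} => u \in A) UE.
  rewrite !inE uC andbT -[u \in <[_]>%g]/(u \in H) /sym_ind.
  have := congr1 (fun A : {set gT} => u \in A) (disjoint_setI0 dis).
  by rewrite !inE; case: (u \in X); case: (u^-1 \in X)%g; case: (u \in H).
(* As v > 1, x is not in H, so M(x) = 1 and x or its inverse lies in X. *)
have [g gX] : exists g, g \in X.
  have := symE x (cycle_id x); rewrite -{2}(expg1 x) mem_cycleX // dvdn1.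
  rewrite (gtn_eqF v1) /sym_ind subr0.
  have [|_] := boolP (x \in X); first by exists x.
  by have [|//] := boolP (x^-1 \in X)%g; exists x^-1%g.
(* This makes the truncated subtraction in lambda exact. *)
have hX : (#|H| <= #|X|)%N.
  rewrite -(card_lcoset H g); apply/subset_leq_card/subsetP=> y /lcosetP[h hH ->].
  exact: per.
have X0 : (0 < #|X|)%N by apply/card_gt0P; exists g.
exists #|X|, (#|X| - #|H|)%N; split.
- by rewrite dE -hE -subzn //; ring.
- by rewrite X0 /= mul2n -addnn -[X in (X < _)%N]addn0 ltn_add2l.
move=> u uC; rewrite dE -hE -(natz #|H|) -count_periodic //.
rewrite -(natz #|X|) -[#|X|%:R]sumr_const -sumrB.
by apply: eq_bigr => y yX; rewrite symE // groupM ?groupV // (subsetP sX).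
Qed.

(** Here M = C - H + x^v H and X + x^v X = C, so X M = (|X| + |H|) C - 2|H| X; hence mu = |X| + |H|
    and d = 2|H|. *)
Lemma conv_of_cond_b : dih_cond_b #[x] x X d -> conv_conclusion.
Proof.
case=> v [v1 vd vn [T [_ XE ME UE]]].
have v0 : (0 < v)%N by apply: ltnW.
set H := <[x ^+ v.*2]>%G; have hE : #|H| = (#[x] %/ v.*2)%N.
  by rewrite -[#|_|]/#[(x ^+ v.*2)%g] orderXdiv.
have dE : d = 2 * #|H|%:Z.
  have v0z : v%:Z != 0 by rewrite -lt0n.
  apply: (mulfI v0z); rewrite vd hE mulrA -!PoszM; congr Posz.
  by rewrite muln2 mulnC divnK.
have per u h : h \in H -> ((u * h)%g \in X) = (u \in X).
  by move=> hH; apply: (periodic_mulG _ XE).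
have abC := cycle_abelian x.
have sH : H \subset <[x]> by apply: cycleX.
have symE u : u \in <[x]>%g ->
    sym_ind X u = 1 - [ind u in H] + [ind (x ^- v * u)%g in H].
  move=> uC; have := congr1 (fun f : {ffun gT -> nat} => f u) ME.
  rewrite !ffunE !inE uC andbT mem_lcoset /sym_ind -!natrD => ->.
  rewrite -[u \in <[_]>%g]/(u \in H) -[(_ * u)%g \in _]/((x ^- v * u)%g \in H) natrD.
  by case: (u \in H); case: ((x ^- v * u)%g \in H).
have xvC : (x ^+ v)%g \in <[x]>%g by apply: mem_cycle.
have xvH : (x ^+ v)%g \notin H.
  by rewrite mem_cycleX // gtnNdvd // -addnn -{1}[v]addn0 ltn_add2l.
have xX : (x ^+ v)%g \in X.
  have := symE _ xvC; rewrite mulVg group1 (negPf xvH) /sym_ind.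
  by case: (_ \in X) => //; case: (_ \in X).
have cover u : u \in <[x]>%g -> (u \in X) || (x ^- v * u \in X)%g.
  by rewrite -UE inE mem_lcoset.
have xv2 u : u \in <[x]>%g -> ((x ^+ v * u)%g \in X) = (x ^- v * u \in X)%g.
  move=> uC; rewrite -(per (x ^- v * u)%g (x ^+ v.*2)%g) ?cycle_id //.
  congr (_ \in X); rewrite -(centsP abC (x ^+ v.*2)%g) ?groupM ?groupV ?mem_cycle //.
  by rewrite -addnn expgD mulgA mulgK.
have HX u : u \in H -> u \notin X.
  move=> uH; have := symE u (subsetP sH u uH); rewrite uH groupMr // groupV (negPf xvH).
  by rewrite /sym_ind; case: (u \in X) => //; case: (u^-1 \in X)%g.
(* X and x^v X cover <x>; they are also disjoint. If u and x^-v u were both in X, covering u^-1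
   would make M equal to 2 at u or at x^v u, and [symE] would put x^-v u or u into H, which misses
   X. *)
have half u : u \in <[x]>%g -> [ind (x ^- v * u)%g in X] = 1 - [ind u in X] :> int.
  move=> uC; have := cover u uC; have [uX _|uX /= -> //] := boolP (u \in X).
  have [yX|//] := boolP (x ^- v * u \in X)%g; exfalso.
  have := cover u^-1%g; rewrite groupV => /(_ uC) /orP[uVX|uVX].
    have := symE u uC; rewrite /sym_ind uX uVX (contraTF (HX u) uX).
    by rewrite (contraTF (HX _) yX).
  have := symE (x ^+ v * u)%g (groupM xvC uC).
  rewrite /sym_ind xv2 // yX invMg (centsP abC u^-1%g) ?groupV // uVX mulKg.
  by rewrite (contraTF (HX u) uX); case: (_ \in H).
have notin_coset y : (y^-1 * x ^+ v \notin H)%g -> y \notin (x ^+ v *: H)%g.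
  by rewrite mem_lcoset -groupV invMg invgK.
(* X contains x^v H and also x or x^-1, both outside that coset as v > 1. Strictness is what mu <
   2|X| requires. *)
have hX : (#|H| < #|X|)%N.
  rewrite -(card_lcoset H (x ^+ v)%g); apply/proper_card/properP; split.
    by apply/subsetP=> y /lcosetP[h hH ->]; rewrite per.
  have := symE x (cycle_id x); rewrite -{2}(expg1 x) mem_cycleX // dvdn1.
  have -> : (v.*2 == 1)%N = false by case: (v) v1 => [|[]].
  rewrite subr0 /sym_ind; have [xX1|_] := boolP (x \in X).
    exists x => //; apply: notin_coset.
    rewrite -{1}(prednK v0) expgS mulKg mem_cycleX // gtnNdvd //.
      by rewrite -ltnS prednK.
    by rewrite -ltnS prednK // ltnS -addnn leq_addr.
  have [xX1 _|//] := boolP (x^-1 \in X)%g; last by case: (_ \in H).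
  exists x^-1%g => //; apply: notin_coset.
  by rewrite invgK -expgS mem_cycleX // gtnNdvd // -addnn -addn1 ltn_add2l.
exists (#|X| + #|H|)%N, (#|X| - #|H|)%N; split.
- by rewrite dE PoszD -subzn ?(ltnW hX) //; ring.
- by rewrite mul2n -addnn ltn_add2l hX andbT addn_gt0 cardG_gt0 orbT.
move=> u uC; have uC' : (x ^- v * u)%g \in <[x]>%g by rewrite groupM ?groupV.
have perX w h : w \in X -> h \in H -> (w * h)%g \in X by move=> wX hH; rewrite per.
have := count_periodic u perX; have := count_periodic (x ^- v * u)%g perX.
rewrite half // => s1 s2.
rewrite (eq_bigr (fun y => 1 - [ind (y^-1 * u)%g in H]
     + [ind (y^-1 * (x ^- v * u))%g in H])); last first.
  move=> y yX; have yC := subsetP sX _ yX; rewrite symE; last by rewrite groupM ?groupV.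
  rewrite [(x ^- v * (y^-1 * u))%g]mulgA (centsP abC (x ^- v)%g) ?groupV //.
  by rewrite mulgA.
rewrite big_split sumrB /= s1 s2 sumr_const dE PoszD -(natz #|X|) -(natz #|H|); ring.
Qed.

End ConvOfConditions.

(** * Dihedrants *)

(** As tau normalizes <x>, the group is <x><tau>. Its order 2n forces equality in the bounds n and 2
    for the two orders, and a trivial intersection. *)
Lemma dihedral_gens_structure (gT : finGroupType) n (x tau : gT) :
    0 < n -> #|[set: gT]| = n.*2 -> <<[set x; tau]>> = [set: gT] ->
    x ^+ n = 1 -> tau ^+ 2 = 1 -> tau * x = x^-1 * tau ->
  [/\ #[x] = n, tau \notin <[x]>, tau * tau = 1,
      forall g, g \in <[x]> -> tau * g = g^-1 * tau
    & forall u, u \in <[x]> \/ (u * tau \in <[x]>)].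
Proof.
move=> n0 cG gen xn t2 tx.
have tt : tau * tau = 1 by rewrite -t2 expgS expg1.
have tV : tau^-1 = tau by apply/eqP; rewrite eq_invg_mul tt.
have xJ : x ^ tau = x^-1 by rewrite conjgE tV mulgA tx -mulgA tt mulg1.
have nrm : <[tau]> \subset 'N(<[x]>).
  by rewrite cycle_subG inE -cycleJ xJ cycleV.
have GE : <[x]> * <[tau]> = [set: gT].
  by rewrite -norm_joinEr // -gen joing_idl joing_idr.
have := mul_cardG <[x]> <[tau]>; rewrite GE cG.
rewrite -[#|<[x]>|]/#[x] -[#|<[tau]>|]/#[tau].
have xle : #[x] <= n by rewrite dvdn_leq ?order_dvdn ?xn.
have tle : #[tau] <= 2 by rewrite dvdn_leq // order_dvdn t2.
have i_gt0 := cardG_gt0 (<[x]> :&: <[tau]>)%G.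
have tle' : #[x] * #[tau] <= n.*2 by rewrite -muln2 leq_mul.
move=> cE; have i1 : #|<[x]> :&: <[tau]>| = 1%N.
  apply/eqP; rewrite eqn_leq i_gt0 andbT -(leq_pmul2l (m := n.*2)) ?muln1 -?cE //.
  by rewrite double_gt0.
rewrite i1 muln1 in cE.
have xn' : #[x] = n.
  apply/eqP; rewrite eqn_leq xle -(leq_pmul2r (m := 2)) // muln2 -cE.
  by rewrite leq_mul2l tle orbT.
have tauC : tau \notin <[x]>.
  apply/negP=> tC; have tI : tau \in <[x]> :&: <[tau]> by rewrite inE tC cycle_id.
  have := i1; rewrite (setIidPr _) ?cycle_subG // -[#|_|]/#[tau] => t1.
  move: cE; rewrite t1 muln1 xn' -addnn => /eqP.
  by rewrite -{1}[n]addn0 eqn_add2l => /eqP n_eq0; rewrite -n_eq0 in n0.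
split=> // [g /cycleP[i ->]|u].
  elim: i => [|i IH]; first by rewrite invg1 mulg1 mul1g.
  by rewrite expgSr mulgA IH -mulgA tx mulgA -invMg -expgS -expgSr.
have : u \in <[x]> * <[tau]> by rewrite GE inE.
case/mulsgP=> c t cC /cycleP[j ->] ->.
rewrite -(odd_double_half j) expgD -mul2n expgM t2 expg1n mulg1.
case: (odd j); last by rewrite mulg1; left.
by right; rewrite expg1 -mulgA tt mulg1.
Qed.

(** * The square of the connection set *)

Section DihedrantConvolution.
Local Open Scope ring_scope.
Variables (gT : finGroupType) (x tau : gT) (X : {set gT}).
Hypotheses (sX : X \subset <[x]>%g) (tauC : tau \notin <[x]>%g).
Hypotheses (tt : (tau * tau = 1)%g)
  (tg : forall g, g \in <[x]>%g -> (tau * g = g^-1 * tau)%g)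
  (CD : forall u, u \in <[x]>%g \/ (u * tau)%g \in <[x]>%g).

Let S := (X :|: X :* tau)%g.
Let SS u : int := \sum_y [ind y in S] * [ind (y^-1 * u)%g in S].

Lemma tauV : (tau^-1 = tau)%g.
Proof. by apply/eqP; rewrite eq_invg_mul tt. Qed.

Lemma conn_tau u : ((u * tau)%g \in S) = (u \in S).
Proof. by rewrite !inE !mem_rcoset mulgK tauV orbC. Qed.

Lemma conn_cycle g : g \in <[x]>%g -> (g \in S) = (g \in X).
Proof.
move=> gC; rewrite inE mem_rcoset tauV.
suff /negPf-> : (g * tau)%g \notin X by rewrite orbF.
by apply: contra tauC => /(subsetP sX); rewrite groupMl.
Qed.

Lemma sum_conn (F : gT -> int) :
  \sum_(y in S) F y = \sum_(y in X) (F y + F (y * tau)%g).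
Proof.
rewrite (big_setID X) /S setUK big_split /=; congr (_ + _).
rewrite [LHS](reindex_inj (mulIg tau)) /=; apply: eq_bigl => y.
rewrite !inE mem_rcoset mulgK andb_orr andNb /=; case: (boolP (y \in X)) => yX.
  rewrite andbT; apply: contra tauC => /(subsetP sX).
  by rewrite groupMl // (subsetP sX _ yX).
by rewrite andbF.
Qed.

Lemma card_conn : #|S| = (2 * #|X|)%N.
Proof.
apply/eqP; rewrite -(eqr_nat int); have := sum_conn (fun=> 1).
by rewrite !sumr_const => ->; rewrite mulrnA.
Qed.

Lemma SS_tau u : SS (u * tau)%g = SS u.
Proof. by apply: eq_bigr => y _; rewrite mulgA conn_tau. Qed.

(** The elements y tau of S account for X^(-1): (y tau)^-1 g = (y^-1 g)^-1 tau, and S is stable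
    under right translation by tau. *)
Lemma SS_cycle g : g \in <[x]>%g ->
  SS g = \sum_(y in X) sym_ind X (y^-1 * g)%g.
Proof.
move=> gC; rewrite /SS.
transitivity (\sum_(y in S) [ind (y^-1 * g)%g in S] : int).
  rewrite [RHS]big_mkcond; apply: eq_bigr => y _.
  by case: (y \in S); rewrite ?mul1r ?mul0r.
rewrite sum_conn; apply: eq_bigr => y yX; have yC := subsetP sX _ yX.
rewrite /sym_ind conn_cycle ?groupM ?groupV //; congr (_ + _%:R).
rewrite invMg tauV -mulgA tg ?groupM ?groupV //.
by rewrite conn_tau conn_cycle ?groupV ?groupM ?groupV.
Qed.

Lemma dih_dsrgP n (mu la t : nat) : #|gT| = n.*2 ->
  is_dsrg (dih tau X X) n.*2 (2 * #|X|) mu la t <->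
  [/\ t = mu, (0 < mu < 2 * #|X|)%N
    & forall g, g \in <[x]>%g -> \sum_(y in X) sym_ind X (y^-1 * g)%g =
        mu%:Z - (mu%:Z - la%:Z) * [ind g in X]].
Proof.
move=> cG.
have AE : adj (dih tau X X) = conv_mx (fun u => [ind u in S]).
  by apply/matrixP => i j; rewrite !mxE.
pose J : 'M[int]_#|gT| := const_mx 1.
have JE : const_mx 1 = conv_mx (fun=> 1) :> 'M[int]_#|gT|.
  by apply/matrixP => i j; rewrite !mxE.
have A2E : (adj (dih tau X X) *m adj (dih tau X X) =
    t%:R *: 1%:M + la%:R *: adj (dih tau X X)
    + mu%:R *: (J - 1%:M - adj (dih tau X X))) <->
   forall u, SS u = t%:R * (u == 1%g)%:R + la%:R * [ind u in S]
     + mu%:R * (1 - (u == 1%g)%:R - [ind u in S]).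
  rewrite AE /J JE conv_mxM -[1%:M]/(1 : 'M[int]__) -(conv_mx1 gT int).
  rewrite !conv_mxB !conv_mxZ !conv_mxD.
  by split=> [/conv_mx_inj|/eq_conv_mx].
have JA : J *m adj (dih tau X X) = (2 * #|X|)%:R *: J.
  rewrite AE /J JE conv_mxM conv_mxZ -card_conn; apply: eq_conv_mx => u.
  rewrite (reindex_inj (mulgI u)) /= (reindex_inj invg_inj) /= mulr1.
  rewrite -sumr_const [RHS]big_mkcond; apply: eq_bigr => y _.
  by rewrite invMg invgK mulgKV mul1r; case: (y \in S).
have AJ : adj (dih tau X X) *m J = (2 * #|X|)%:R *: J.
  rewrite AE /J JE conv_mxM conv_mxZ -card_conn; apply: eq_conv_mx => u.
  rewrite mulr1 -sumr_const [RHS]big_mkcond; apply: eq_bigr => y _.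
  by rewrite mulr1; case: (y \in S).
have ptw u : u \in <[x]>%g -> (u * tau == 1)%g = false.
  move=> uC; apply/eqP=> ut; case/negP: tauC.
  by rewrite -(groupMl _ uC) ut group1.
split=> [[_ _ _ /A2E E tk]|[tmu muk conv]].
  (* S and S^2 take equal values at 1 and tau, the identity matrix does not; the difference of the
     two equations is t = mu. *)
  have tmu : t = mu.
    have := E 1%g; rewrite -(SS_tau 1%g) E ptw ?group1 // conn_tau eqxx => e1.
    apply/eqP; rewrite -(eqr_nat int); apply/eqP; move: e1.
    by rewrite mulr0 mulr1 mulr0n; case: (_ \in S); rewrite ?mulr0n ?mulr1n; lra.
  rewrite -tmu in E *; split=> // g gC; rewrite -SS_cycle // -[SS g]SS_tau E.
  by rewrite ptw // conn_tau conn_cycle // !natz; ring.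
split=> //; last by rewrite tmu.
apply/A2E; rewrite tmu => u.
(* With t = mu the identity terms cancel, and invariance under tau reduces the equation to <x>. *)
suff E g : g \in <[x]>%g -> SS g = mu%:R + (la%:R - mu%:R) * [ind g in S].
  have -> : SS u = mu%:R + (la%:R - mu%:R) * [ind u in S]; last by ring.
  by have [/E //|/E] := CD u; rewrite SS_tau conn_tau.
by move=> gC; rewrite SS_cycle // conv // conn_cycle // !natz; ring.
Qed.

End DihedrantConvolution.

Theorem theorem1p4 (n : nat) (hn : 3 <= n) (x tau : 'D_(n.*2))
    (hD : dihedral_gens x tau) (X : {set 'D_(n.*2)})
    (hX : X \subset (<[x]> :\ 1)%g) (d : int) :
  (exists mu la t : nat,
     (mu%:Z - la%:Z = d)%R /\ is_dsrg (dih tau X X) n.*2 (2 * #|X|) mu la t)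
  <-> (dih_cond_a n x X d \/ dih_cond_b n x X d).
Proof.
have cD : #|'D_(n.*2)| = n.*2 by rewrite card_dihedral // ltnW.
have [gen x_n t2 tx] := hD.
have [xn tauC tt tg CD] :=
  dihedral_gens_structure (ltnW (ltnW hn)) cD gen x_n t2 tx.
have sX : X \subset <[x]> by move: hX; rewrite subsetD1 => /andP[].
have dsrgP mu la t := dih_dsrgP sX tauC tt tg CD mu la t (etrans (esym (cardsT _)) cD).
have condE : dih_cond_a n x X d \/ dih_cond_b n x X d <->
    dih_cond_a #[x] x X d \/ dih_cond_b #[x] x X d by rewrite xn.
split=> [[mu [la [t [dE /dsrgP[_ /andP[mu0 muX] +]]]]]|/condE cond].
  rewrite dE => conv.
  apply/condE/(conditions_of_conv hX _ _ conv); last by rewrite natz ltz_nat.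
  by rewrite -card_gt0; move: (ltn_trans mu0 muX); rewrite muln_gt0.
have [mu [la [dE muX conv]]] : exists mu la : nat, [/\ (mu%:Z - la%:Z = d)%R,
    0 < mu < 2 * #|X| & forall g, g \in <[x]> -> (\sum_(y in X) sym_ind X (y^-1 * g)%g
      = mu%:Z - d * [ind g in X])%R].
  by case: cond => [/(conv_of_cond_a hX)|/(conv_of_cond_b hX)].
by exists mu, la, mu; split=> //; apply/dsrgP; rewrite dE.
Qed.
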